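(* Let $d$ and $m$ be strictly positive integers, let $h>0$ be the time step, and let $A=I_{\mathcal{N}_m-d}-h\,\tilde{\Delta}_m$ be the iteration matrix of the explicit finite difference scheme for the heat equation on the $m$-th graph approximation of the Sierpiński simplex with $d$ corner points. Denote by $\gamma_i$, $i=1,\dots,\mathcal{N}_m-d$, the eigenvalues of $A$. Then $$\forall\, i=1,\dots,\mathcal{N}_m-d:\qquad h\,(d+2)^m\leq\frac{2}{d^2}\ \Longrightarrow\ |\gamma_i|\leq 1 .$$
   Context: Let $P_0,\dots,P_{d-1}\in\mathbb{R}^{d-1}$ be the vertices of a nondegenerate simplex (affinely independent points). For $1\leq i\leq d$ let $f_i(X)=\frac12(X+P_{i-1})$ on $\mathbb{R}^{d-1}$. Set $V_0=\{P_0,\dots,P_{d-1}\}$ and $V_m=\bigcup_{i=1}^d f_i(V_{m-1})$ for $m\geq 1$; $\mathcal{N}_m$ is the cardinality of $V_m$. For a word $w=w_1\cdots w_m\in\{1,\dots,d\}^m$ put $f_w=f_{w_1}\circ\cdots\circ f_{w_m}$. For distinct $X,Y\in V_m$ write $X\underset{m}{\sim}Y$ iff there is a word $w\in\{1,\dots,d\}^m$ with $X,Y\in f_w(V_0)$. Enumerate $V_m\setminus V_0=\{X_1,\dots,X_{\mathcal{N}_m-d}\}$. The explicit scheme (time step $h$, zero boundary values on $V_0$) is $$\frac{u^m_h((k+1)h,X_i)-u^m_h(kh,X_i)}{h}=\frac d2(d+2)^m\sum_{Y\underset{m}{\sim}X_i}\bigl(u^m_h(kh,Y)-u^m_h(kh,X_i)\bigr),\qquad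 u^m_h(kh,P_j)=0,$$ for $1\le i\le \mathcal{N}_m-d$, $0\le j\le d-1$. In terms of the vectors $U^m_h(k)=(u^m_h(kh,X_i))_{1\leq i\leq \mathcal{N}_m-d}$ it reads $U^m_h(k+1)=A\,U^m_h(k)$ with $A=I_{\mathcal{N}_m-d}-h\,\tilde{\Delta}_m$. Here $I_{\mathcal{N}_m-d}$ is the identity matrix, and $\tilde\Delta_m$ is the $(\mathcal{N}_m-d)\times(\mathcal{N}_m-d)$ normalized (Dirichlet) Laplacian matrix, defined by $$(\tilde\Delta_m v)_i=\frac d2(d+2)^m\sum_{Y\underset{m}{\sim}X_i}\bigl(v(X_i)-v(Y)\bigr),$$ where $v=(v(X_i))_i$ is extended by $v=0$ on $V_0$. *)

(* Defs.v *)
From mathcomp Require Export all_boot all_order all_algebra.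
From mathcomp Require Export finmap.
From mathcomp Require Export reals.
From mathcomp Require Export complex.

Set Implicit Arguments.
Unset Strict Implicit.
Unset Printing Implicit Defensive.

Import GRing.Theory Num.Theory.

Local Open Scope ring_scope.

Definition affinely_independent (R : realType) (d n : nat)
    (P : 'I_d -> 'rV[R]_n) : Prop :=
  forall c : 'I_d -> R,
    \sum_i c i = 0 -> \sum_i c i *: P i = 0 -> forall i, c i = 0.

(* Indices of corners and maps start at 0: [simplex_map P i] fixes [P i]. *)
Definition simplex_map (R : realType) (d n : nat) (P : 'I_d -> 'rV[R]_n)
    (i : 'I_d) (X : 'rV[R]_n) : 'rV[R]_n :=
  2^-1 *: (X + P i).

Definition word_map (R : realType) (d n : nat) (P : 'I_d -> 'rV[R]_n)
    (w : seq 'I_d) (X : 'rV[R]_n) : 'rV[R]_n :=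
  foldr (simplex_map P) X w.

Definition corners (R : realType) (d n : nat) (P : 'I_d -> 'rV[R]_n) :
    {fset 'rV[R]_n} :=
  [fset P i | i in 'I_d]%fset.

Fixpoint vertices (R : realType) (d n : nat) (P : 'I_d -> 'rV[R]_n)
    (m : nat) : {fset 'rV[R]_n} :=
  if m is m'.+1 then
    (\bigcup_(i in 'I_d) [fset simplex_map P i X | X in vertices P m'])%fset
  else corners P.

Definition adjacent (R : realType) (d n : nat) (P : 'I_d -> 'rV[R]_n)
    (m : nat) (X Y : 'rV[R]_n) : bool :=
  (X != Y) &&
  [exists w : m.-tuple 'I_d,
     (X \in [fset word_map P w Z | Z in corners P]%fset) &&
     (Y \in [fset word_map P w Z | Z in corners P]%fset)].

(* No enumeration of the interior vertices is singled out. *)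
Definition interior_enumeration (R : realType) (d n : nat)
    (P : 'I_d -> 'rV[R]_n) (m N : nat) (X : 'I_N -> 'rV[R]_n) : Prop :=
  injective X /\
  forall Y, Y \in (vertices P m `\` corners P)%fset <-> exists i, X i = Y.

(* The function whose value at [X i] is [v i 0], and 0 elsewhere. *)
Definition zero_extension (R : realType) (n N : nat) (X : 'I_N -> 'rV[R]_n)
    (v : 'cV[R]_N) (Y : 'rV[R]_n) : R :=
  if [pick i | X i == Y] is Some i then v i 0 else 0.

Definition dirichlet_laplacian (R : realType) (d n : nat)
    (P : 'I_d -> 'rV[R]_n) (m N : nat) (X : 'I_N -> 'rV[R]_n)
    (v : 'cV[R]_N) : 'cV[R]_N :=
  \col_i (d%:R / 2 * (d + 2)%:R ^+ m *
    \sum_(Y <- vertices P m | adjacent P m Y (X i))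
      (zero_extension X v (X i) - zero_extension X v Y)).

Definition laplacian_mx (R : realType) (d n : nat) (P : 'I_d -> 'rV[R]_n)
    (m N : nat) (X : 'I_N -> 'rV[R]_n) : 'M[R]_N :=
  \matrix_(i, j) dirichlet_laplacian P m X (delta_mx j 0) i 0.

Lemma laplacian_mxE (R : realType) (d n : nat) (P : 'I_d -> 'rV[R]_n)
    (m N : nat) (X : 'I_N -> 'rV[R]_n) (v : 'cV[R]_N) :
  laplacian_mx P m X *m v = dirichlet_laplacian P m X v.
Proof.
have extE Y : zero_extension X v Y =
    \sum_j zero_extension X (delta_mx j 0) Y * v j 0.
  rewrite /zero_extension; case: pickP => [i _|_].
    rewrite (bigD1 i) //= mxE !eqxx mul1r big1 ?addr0 // => j ji.
    by rewrite mxE eq_sym (negbTE ji) mul0r.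
  by rewrite big1 // => j _; rewrite mul0r.
apply/colP => i; rewrite mxE [RHS]mxE.
set c := d%:R / 2 * _.
transitivity (\sum_j c * (\sum_(Y <- vertices P m | adjacent P m Y (X i))
    (zero_extension X (delta_mx j 0) (X i) -
     zero_extension X (delta_mx j 0) Y) * v j 0)).
  by apply: eq_bigr => j _; rewrite mxE [X in X * _]mxE -mulr_suml mulrA.
rewrite -mulr_sumr; congr (_ * _).
rewrite exchange_big /=; apply: eq_bigr => Y _; rewrite !extE -sumrB.
by apply: eq_bigr => j _; rewrite mulrBl.
Qed.

Definition iteration_mx (R : realType) (d n : nat) (P : 'I_d -> 'rV[R]_n)
    (m N : nat) (X : 'I_N -> 'rV[R]_n) (h : R) : 'M[R]_N :=
  1%:M - h *: laplacian_mx P m X.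

(* The eigenvalues of a real matrix, listed with algebraic multiplicity.
   They are taken in R[i], so that such a list exists for every A. *)
Definition eigenvalue_list (R : realType) (N : nat) (A : 'M[R]_N)
    (gamma : 'I_N -> R[i]) : Prop :=
  char_poly (map_mx (real_complex R) A) = \prod_i ('X - (gamma i)%:P).

(* Main.v *)
Require Import Defs.
From mathcomp Require Import ring lra zify.

Set Implicit Arguments.
Unset Strict Implicit.
Unset Printing Implicit Defensive.

Import GRing.Theory Num.Theory Order.TTheory.
Local Open Scope ring_scope.

(** The Laplacian is [d / 2 * (d + 2) ^ m] times the matrix of a Dirichlet form,
    [energy]: the sum of the squares of the increments of a function over the
    edges of the graph (lemma [dot_laplacian]).  Hence the iteration matrix is
    self-adjoint, its eigenvalues are real, and it is enough to bound its
    quadratic form by the squared norm (lemma [selfadjoint_eigenvalue_le1]).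
    As the energy is nonnegative, what has to be shown is that it is at most
    [2 d] times the squared norm: then the form of [h] times the Laplacian lies
    between [0] and [h * (d / 2) * (d + 2) ^ m * 2 d = h * (d + 2) ^ m * d ^ 2]
    times the squared norm, and the hypothesis on [h] says that this last factor
    is at most [2].

    Counting the neighbours of a vertex, as Gershgorin's theorem does, would
    give [4 (d - 1)] in place of [2 d], which is too large for [d > 2].  The
    bound [2 d] comes from the decomposition into cells: every edge lies in some
    cell, a complete graph on the [d] images of the corners, and

    - the Laplacian of a complete graph on [d] vertices is at most [d]
      (lemma [sum_pairs_sqr_le]);
    - a vertex belongs to at most two cells (lemma [card_addresses_le2]).

    For the second point, multiply the barycentric coordinates of the image of
    corner [j] under the word [w] by [2 ^ size w]; affine independence makes
    the resulting integer vectors [bary w j] comparable, and the count becomes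
    an induction on words.  Two addresses of one vertex with distinct first
    letters [k1] and [k2] give it coordinate at least one half at both [k1] and
    [k2], so the vertex is the midpoint of these two corners, and each of the
    two letters can be continued in one way only. *)

(** * Eigenvalues of self-adjoint real matrices *)

Definition dot (R : realType) (N : nat) (x y : 'cV[R]_N) : R :=
  \sum_i x i 0 * y i 0.

Lemma dotC (R : realType) (N : nat) (x y : 'cV[R]_N) : dot x y = dot y x.
Proof. by apply: eq_bigr => i _; rewrite mulrC. Qed.

Lemma dotDr (R : realType) (N : nat) (x y z : 'cV[R]_N) :
  dot x (y + z) = dot x y + dot x z.
Proof. by rewrite -big_split; apply: eq_bigr => i _; rewrite mxE mulrDr. Qed.

Lemma dotZr (R : realType) (N : nat) (a : R) (x y : 'cV[R]_N) :
  dot x (a *: y) = a * dot x y.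
Proof. by rewrite mulr_sumr; apply: eq_bigr => i _; rewrite mxE mulrCA. Qed.

Lemma dotBr (R : realType) (N : nat) (x y z : 'cV[R]_N) :
  dot x (y - z) = dot x y - dot x z.
Proof. by rewrite -scaleN1r dotDr dotZr mulN1r. Qed.

Lemma dot_ge0 (R : realType) (N : nat) (x : 'cV[R]_N) : 0 <= dot x x.
Proof. by apply: sumr_ge0 => i _; rewrite -expr2 sqr_ge0. Qed.

Lemma dot_eq0 (R : realType) (N : nat) (x : 'cV[R]_N) :
  dot x x = 0 -> x = 0.
Proof.
move=> /eqP; rewrite psumr_eq0 => [/allP x0|i _]; last by rewrite -expr2 sqr_ge0.
apply/colP => i; apply/eqP; rewrite mxE -sqrf_eq0 expr2.
exact: x0 (mem_index_enum i).
Qed.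

(** A complex eigenvector of a real matrix amounts to a pair of real vectors that
    the matrix rotates and scales; this lets the proof below stay over [R]. *)
Lemma complex_eigenvector_parts (R : realType) (N : nat) (A : 'M[R]_N)
    (g : R[i]) (v : 'cV[R[i]]_N) :
  let a := map_mx (@complex.Re R) v in let b := map_mx (@complex.Im R) v in
  map_mx (real_complex R) A *m v = g *: v ->
  A *m a = complex.Re g *: a - complex.Im g *: b /\
  A *m b = complex.Re g *: b + complex.Im g *: a.
Proof.
move=> a b Av.
have ReM (x y : R[i]) : complex.Re (x * y) =
    complex.Re x * complex.Re y - complex.Im x * complex.Im y.
  by case: x y => [? ?] [].
have ImM (x y : R[i]) : complex.Im (x * y) =
    complex.Re x * complex.Im y + complex.Im x * complex.Re y.
  by case: x y => [? ?] [].
have ReD : {morph @complex.Re R : x y / x + y >-> x + y}.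
  by move=> [? ?] [].
have ImD : {morph @complex.Im R : x y / x + y >-> x + y}.
  by move=> [? ?] [].
split; apply/colP => i; move/colP/(_ i): Av; rewrite !mxE.
- move=> /(congr1 (@complex.Re R)); rewrite (big_morph _ ReD (erefl _)) ReM => <-.
  by apply: eq_bigr => j _; rewrite !mxE ReM /= mul0r subr0.
- move=> /(congr1 (@complex.Im R)); rewrite (big_morph _ ImD (erefl _)) ImM => <-.
  by apply: eq_bigr => j _; rewrite !mxE ImM /= mul0r addr0.
Qed.

(** With [a + i b] an eigenvector for [g = al + i be], the two expansions of
    [dot a (A *m b) = dot b (A *m a)] differ by [be * (dot a a + dot b b)], so
    [be = 0]; then [a] and [b] both satisfy [A *m x = al *: x], and the bound on
    the quadratic form at the nonzero one of them gives the bound on [al]. *)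
Lemma selfadjoint_eigenvalue_le1 (R : realType) (N : nat) (A : 'M[R]_N)
    (g : R[i]) :
  (forall x y, dot x (A *m y) = dot y (A *m x)) ->
  (forall x, `|dot x (A *m x)| <= dot x x) ->
  root (char_poly (map_mx (real_complex R) A)) g -> `|g| <= 1.
Proof.
move=> Asym Ale; rewrite -eigenvalue_root_char => /eigenvalueP [v vA v0].
have dotd (B : 'M[R]_N) i j : dot (delta_mx i 0) (B *m delta_mx j 0) = B i j.
  rewrite -colE /dot (bigD1 i) //= big1 => [|k ki]; rewrite !mxE ?eqxx ?(negPf ki).
    by rewrite mul1r addr0.
  by rewrite mul0r.
(* An eigenvalue comes with a row eigenvector; symmetry makes it a column one. *)
have AT : A^T = A by apply/matrixP => i j; rewrite mxE -!dotd Asym.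
have Av : map_mx (real_complex R) A *m v^T = g *: v^T.
  by rewrite -{1}AT -map_trmx -trmx_mul vA linearZ.
have [] := complex_eigenvector_parts Av.
set a := map_mx _ _; set b := map_mx _ _.
move: (complex.Re g) (complex.Im g) (complexE g).
move=> al be gE Aa Ab.
have ab0 : 0 < dot a a + dot b b.
  rewrite lt_def addr_ge0 ?dot_ge0 // andbT; apply: contra_neq v0 => ab0.
  have := dot_ge0 a; have := dot_ge0 b => b_ge0 a_ge0.
  have a0 : a = 0 by apply: dot_eq0; lra.
  have b0 : b = 0 by apply: dot_eq0; lra.
  apply/rowP => i; move/colP/(_ i): a0; move/colP/(_ i): b0; rewrite !mxE.
  by case: (v 0 i) => x y /= -> ->.
have be0 : be = 0.
  have := Asym a b; rewrite Aa Ab dotDr dotBr !dotZr (dotC b a) => E.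
  suff /eqP : be * (dot a a + dot b b) = 0 by rewrite mulf_eq0 (gt_eqF ab0) orbF => /eqP.
  lra.
have all : `|al| * (dot a a + dot b b) <= dot a a + dot b b.
  rewrite mulrDr; apply: lerD.
    rewrite -[X in _ * X]ger0_norm ?dot_ge0 // -normrM -dotZr.
    by have := Ale a; rewrite Aa be0 scale0r subr0.
  rewrite -[X in _ * X]ger0_norm ?dot_ge0 // -normrM -dotZr.
    by have := Ale b; rewrite Ab be0 scale0r addr0.
have al1 : `|al| <= 1 by rewrite -(ler_pM2r ab0) mul1r.
by rewrite gE be0 mulr0 addr0 normc_def /= expr0n addr0 sqrtr_sqr lecE /= eqxx.
Qed.

(** * Integer barycentric coordinates *)

(** The barycentric coordinates of [word_map P w (P j)] multiplied by
    [2 ^ size w], so that they are natural numbers: the first letter of a word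
    is the map applied last and carries half of the total weight. *)
Fixpoint bary (d : nat) (w : seq 'I_d) (j i : 'I_d) : nat :=
  if w is k :: w' then (k == i) * 2 ^ size w' + bary w' j i else (j == i).

Lemma sum_bary (d : nat) (w : seq 'I_d) (j : 'I_d) :
  (\sum_i bary w j i = 2 ^ size w)%N.
Proof.
have sum1 (k : 'I_d) : (\sum_i (k == i) = 1)%N.
  by rewrite (bigD1 k) //= eqxx big1 // => i; rewrite eq_sym => /negPf->.
elim: w => [|k w IH] /=; first exact: sum1.
by rewrite big_split -big_distrl /= sum1 IH mul1n expnS mul2n addnn.
Qed.

Lemma bary_le (d : nat) (w : seq 'I_d) (j i : 'I_d) : (bary w j i <= 2 ^ size w)%N.
Proof. by rewrite -(sum_bary w j) (bigD1 i) //= leq_addr. Qed.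

(** Each letter contributes its whole weight to a single coordinate, hence the
    total weight is reached only if all the letters agree: a corner has a single
    address of each length. *)
Lemma bary_corner (d : nat) (w : seq 'I_d) (j i : 'I_d) :
  bary w j i = (2 ^ size w)%N -> w = nseq (size w) i /\ j = i.
Proof.
elim: w => [|k w IH] /=; first by case: eqP.
have := bary_le w j i; rewrite expnS mul2n -addnn => le.
case: eqP => [ki|_] E.
  have [|{1}-> ->] := IH; first by lia.
  by rewrite ki.
by have := expn_gt0 2 (size w); lia.
Qed.

(** The weight of the letter [k1] is half of the total, so the other address must
    put its whole remaining weight on [k1], and symmetrically for [k2]. *)
Lemma bary_split (d : nat) (n : nat) (k1 k2 : 'I_d) (w1 w2 : seq 'I_d)
    (j1 j2 : 'I_d) :
  size w1 = n -> size w2 = n -> k1 != k2 ->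
  bary (k1 :: w1) j1 =1 bary (k2 :: w2) j2 ->
  (w1, j1) = (nseq n k2, k2) /\ (w2, j2) = (nseq n k1, k1).
Proof.
move=> s1 s2 k12 E.
have := E k1; have := E k2; rewrite /= !eqxx (eq_sym k2) !(negPf k12) s1 s2 => E2 E1.
have le1 := bary_le w1 j1 k2; have le2 := bary_le w2 j2 k1.
rewrite s1 in le1; rewrite s2 in le2.
have [w1E ->] : w1 = nseq (size w1) k2 /\ j1 = k2 by apply: bary_corner; rewrite s1; lia.
have [w2E ->] : w2 = nseq (size w2) k1 /\ j2 = k1 by apply: bary_corner; rewrite s2; lia.
by rewrite w1E w2E s1 s2.
Qed.

(** The conclusion expresses that the fibres of [bary] over words of length [n]
    have at most two elements.  If the first letters agree, drop them; otherwise,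
    by [bary_split], an address is determined by its first letter, and a third
    letter, distinct from the two others, would have to be followed by both. *)
Lemma bary_fibre (d : nat) (n : nat) (w1 w2 w3 : seq 'I_d) (j1 j2 j3 : 'I_d) :
  size w1 = n -> size w2 = n -> size w3 = n ->
  bary w1 j1 =1 bary w2 j2 -> bary w2 j2 =1 bary w3 j3 ->
  [\/ (w1, j1) = (w2, j2), (w2, j2) = (w3, j3) | (w3, j3) = (w1, j1)].
Proof.
elim: n w1 w2 w3 => [|n IH] [|k1 w1] [|k2 w2] [|k3 w3] //=.
  (* For empty words, [bary] is the indicator of the corner. *)
  move=> _ _ _ /(_ j1) /=; rewrite eqxx => E _; constructor 1.
  by move: E; case: eqP => // ->.
move=> [s1] [s2] [s3] E12 E23.
have E13 i := etrans (E12 i) (E23 i).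
have [k12|k12] := eqVneq k1 k2; have [k23|k23] := eqVneq k2 k3.
- subst k2 k3.
  have {}E12 : bary w1 j1 =1 bary w2 j2 by move=> i; have := E12 i; rewrite s1 s2 => /addnI.
  have {}E23 : bary w2 j2 =1 bary w3 j3 by move=> i; have := E23 i; rewrite s2 s3 => /addnI.
  by case: (IH _ _ _ s1 s2 s3 E12 E23) => -[-> ->]; [constructor 1|constructor 2|constructor 3].
- subst k2; constructor 1.
  by have [[-> ->] _] := bary_split s1 s3 k23 E13; have [[-> ->] _] := bary_split s2 s3 k23 E23.
- subst k3; constructor 2.
  by have [_ [-> ->]] := bary_split s1 s2 k12 E12; have [_ [-> ->]] := bary_split s1 s3 k12 E13.
- (* The letter [k2] is followed by [k1], by comparison with the first address,
     and by [k3], by comparison with the third one. *)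
  have [[w1E j1E] [w2E j2E]] := bary_split s1 s2 k12 E12.
  have [[_ j2E'] [w3E j3E]] := bary_split s2 s3 k23 E23.
  have k13 : k1 = k3 by rewrite -j2E.
  by constructor 3; rewrite w3E w1E j3E j1E k13.
Qed.

(** * Addresses of the vertices *)

Lemma scale_word_map (R : realType) (d n : nat) (P : 'I_d -> 'rV[R]_n)
    (w : seq 'I_d) (j : 'I_d) :
  2 ^+ size w *: word_map P w (P j) = \sum_i (bary w j i)%:R *: P i.
Proof.
have sum1 (k : 'I_d) (c : R) : \sum_i ((k == i)%:R * c) *: P i = c *: P k.
  rewrite (bigD1 k) //= eqxx mul1r big1 ?addr0 // => i.
  by rewrite eq_sym => /negPf->; rewrite mul0r scale0r.
elim: w => [|k w IH] /=.
  by rewrite expr0 -sum1; apply: eq_bigr => i _; rewrite mulr1.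
rewrite /simplex_map scalerA exprSr mulfK ?pnatr_eq0 // scalerDr IH addrC -sum1 -big_split.
by apply: eq_bigr => i _; rewrite /= -scalerDl natrD natrM natrX.
Qed.

Lemma word_map_bary (R : realType) (d n : nat) (P : 'I_d -> 'rV[R]_n)
    (w1 w2 : seq 'I_d) (j1 j2 : 'I_d) :
  affinely_independent P -> size w1 = size w2 ->
  word_map P w1 (P j1) = word_map P w2 (P j2) -> bary w1 j1 =1 bary w2 j2.
Proof.
move=> hP sz E i.
have := hP (fun i => (bary w1 j1 i)%:R - (bary w2 j2 i)%:R) _ _ i.
move=> /(_ _ _)/subr0_eq/eqP; rewrite eqr_nat => H; apply/eqP/H.
  by rewrite sumrB -!natr_sum !sum_bary sz subrr.
under eq_bigr do rewrite scalerBl.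
by rewrite sumrB -!scale_word_map sz E subrr.
Qed.

Lemma card_addresses_le2 (R : realType) (d n m : nat) (P : 'I_d -> 'rV[R]_n)
    (Y : 'rV[R]_n) : affinely_independent P ->
  (#|[pred p : m.-tuple 'I_d * 'I_d | word_map P p.1 (P p.2) == Y]| <= 2)%N.
Proof.
move=> hP; rewrite leqNgt; apply/card_gt2P => -[[w1 j1] [[w2 j2] [[w3 j3]]]].
rewrite !inE /= => -[[/eqP E1 /eqP E2 /eqP E3] [n12 n23 n31]].
have [s1 s2 s3] := And3 (size_tuple w1) (size_tuple w2) (size_tuple w3).
have E12 := word_map_bary hP (etrans s1 (esym s2)) (etrans E1 (esym E2)).
have E23 := word_map_bary hP (etrans s2 (esym s3)) (etrans E2 (esym E3)).
case: (bary_fibre s1 s2 s3 E12 E23) => -[/val_inj wE jE].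
- by rewrite wE jE eqxx in n12.
- by rewrite wE jE eqxx in n23.
- by rewrite wE jE eqxx in n31.
Qed.

Lemma word_map_vertices (R : realType) (d n : nat) (P : 'I_d -> 'rV[R]_n)
    (w : seq 'I_d) (j : 'I_d) : word_map P w (P j) \in vertices P (size w).
Proof.
elim: w => [|k w IH] /=; first exact: in_imfset.
apply/bigfcupP; exists k; first by rewrite mem_index_enum.
exact: in_imfset.
Qed.

Lemma adjacentP (R : realType) (d n m : nat) (P : 'I_d -> 'rV[R]_n)
    (Y Z : 'rV[R]_n) : adjacent P m Y Z ->
  exists (w : m.-tuple 'I_d) j k, Y = word_map P w (P j) /\ Z = word_map P w (P k).
Proof.
case/andP => _ /existsP [w /andP [/imfsetP [_ /imfsetP [j _ ->] ->]]].
by move=> /imfsetP [_ /imfsetP [k _ ->] ->]; exists w, j, k.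
Qed.

Lemma adjacentC (R : realType) (d n m : nat) (P : 'I_d -> 'rV[R]_n)
    (Y Z : 'rV[R]_n) : adjacent P m Y Z = adjacent P m Z Y.
Proof.
by rewrite /adjacent eq_sym; congr (_ && _); apply: eq_existsb => w; rewrite andbC.
Qed.

(** * The energy of a function on the vertices *)

Lemma sum_fibres (R : realType) (I : finType) (T : eqType) (s : seq T)
    (phi : I -> T) (G : T -> R) : uniq s -> (forall i, phi i \in s) ->
  \sum_i G (phi i) = \sum_(x <- s) G x *+ #|[pred i | phi i == x]|.
Proof.
move=> us phis.
have -> : \sum_i G (phi i) = \sum_i \sum_(x <- s | phi i == x) G x.
  apply: eq_bigr => i _; rewrite big_mkcond (bigD1_seq (phi i)) //= eqxx.
  by rewrite big1 ?addr0 // => x; rewrite eq_sym => /negPf->.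
rewrite (exchange_big_dep predT) //=; apply: eq_bigr => x _.
by rewrite sumr_const.
Qed.

(** The quadratic form of the complete graph: the difference of the two sides is
    [2 * (\sum_j a j) ^+ 2]. *)
Lemma sum_pairs_sqr_le (R : realType) (d : nat) (a : 'I_d -> R) :
  \sum_j \sum_k (a j - a k) ^+ 2 <= d.*2%:R * \sum_j a j ^+ 2.
Proof.
have -> : \sum_j \sum_k (a j - a k) ^+ 2 =
    d.*2%:R * \sum_j a j ^+ 2 - 2 * (\sum_j a j) ^+ 2.
  transitivity (\sum_j (d%:R * a j ^+ 2 + \sum_k a k ^+ 2 - 2 * a j * \sum_k a k)).
    apply: eq_bigr => j _.
    have sqE k : (a j - a k) ^+ 2 = a j ^+ 2 + a k ^+ 2 - 2 * a j * a k by ring.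
    under eq_bigr do rewrite sqE.
    by rewrite sumrB big_split /= sumr_const card_ord -mulr_sumr -[_ *+ d]mulr_natl.
  rewrite sumrB big_split /= sumr_const card_ord -mulr_sumr -mulr_suml -mulr_sumr.
  by rewrite -muln2 natrM -[_ *+ d]mulr_natl; ring.
by rewrite gerBl mulr_ge0 ?ler0n ?sqr_ge0.
Qed.

(** The factor [2^-1] is there because the double sum meets every edge twice. *)
Definition energy (R : realType) (d n : nat) (P : 'I_d -> 'rV[R]_n) (m : nat)
    (u v : 'rV[R]_n -> R) : R :=
  2^-1 * \sum_(Z <- vertices P m) \sum_(Y <- vertices P m | adjacent P m Y Z)
    (u Z - u Y) * (v Z - v Y).

Lemma energy_ge0 (R : realType) (d n : nat) (P : 'I_d -> 'rV[R]_n) (m : nat)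
    (u : 'rV[R]_n -> R) : 0 <= energy P m u u.
Proof.
rewrite mulr_ge0 ?invr_ge0 ?ler0n //; apply: sumr_ge0 => Z _.
by apply: sumr_ge0 => Y _; rewrite -expr2 sqr_ge0.
Qed.

(** Every edge is a pair of corner images in some cell, and squares are
    nonnegative, so summing cell by cell can only overcount. *)
Lemma sum_cells_energy (R : realType) (d n : nat) (P : 'I_d -> 'rV[R]_n)
    (m : nat) (u : 'rV[R]_n -> R) :
  2 * energy P m u u <= \sum_(w : m.-tuple 'I_d) \sum_j \sum_k
    (u (word_map P w (P j)) - u (word_map P w (P k))) ^+ 2.
Proof.
rewrite mulrA divff ?pnatr_eq0 // mul1r.
pose phi (t : m.-tuple 'I_d * 'I_d * 'I_d) :=
  (word_map P t.1.1 (P t.1.2), word_map P t.1.1 (P t.2)).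
pose G (p : 'rV[R]_n * 'rV[R]_n) := (u p.1 - u p.2) ^+ 2.
set V : seq _ := vertices P m.
have wV (w : m.-tuple 'I_d) j : word_map P w (P j) \in V.
  by have := word_map_vertices P w j; rewrite size_tuple.
have -> : \sum_(w : m.-tuple 'I_d) \sum_j \sum_k
    (u (word_map P w (P j)) - u (word_map P w (P k))) ^+ 2 = \sum_t G (phi t).
  by rewrite !pair_big.
rewrite (@sum_fibres _ _ _ [seq (Z, Y) | Z <- V, Y <- V]); first last.
- by move=> t; apply/allpairsP; exists (phi t); rewrite /phi /= !wV.
- by apply: allpairs_uniq => //; try exact: fset_uniq; move=> [? ?] [].
rewrite big_allpairs; apply: ler_sum => Z _; rewrite [leLHS]big_mkcond /=.
apply: ler_sum => Y _; case: ifP => [|_]; last by rewrite mulrn_wge0 ?sqr_ge0.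
case/adjacentP => w [k [j [-> ->]]]; rewrite -expr2 -[leLHS]mulr1n; apply: ler_wpMn2l.
  exact: sqr_ge0.
by apply/card_gt0P; exists (w, j, k); rewrite inE.
Qed.

Lemma energy_le (R : realType) (d n : nat) (P : 'I_d -> 'rV[R]_n) (m : nat)
    (u : 'rV[R]_n -> R) : affinely_independent P ->
  energy P m u u <= d.*2%:R * \sum_(Y <- vertices P m) u Y ^+ 2.
Proof.
move=> hP; rewrite -(ler_pM2l (ltr0n R 2)).
apply: le_trans (sum_cells_energy P m u) _.
apply: (@le_trans _ _ (d.*2%:R *
    \sum_(p : m.-tuple 'I_d * 'I_d) u (word_map P p.1 (P p.2)) ^+ 2)).
  rewrite -(pair_big predT predT (fun w j => u (word_map P (val w) (P j)) ^+ 2)) mulr_sumr /=.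
  apply: ler_sum => w _; exact: sum_pairs_sqr_le.
rewrite (@sum_fibres _ _ _ (vertices P m)
  (fun p : m.-tuple _ * _ => word_map P p.1 (P p.2)) (fun Y => u Y ^+ 2)); first last.
- by move=> [w j] /=; have := word_map_vertices P w j; rewrite size_tuple.
- exact: fset_uniq.
rewrite mulrCA ler_wpM2l ?ler0n // mulr_sumr; apply: ler_sum => Y _.
by rewrite -[leLHS]mulr_natl ler_wpM2r ?sqr_ge0 // ler_nat card_addresses_le2.
Qed.

(** * The Laplacian as an energy form *)

Lemma zero_extensionE (R : realType) (n N : nat) (X : 'I_N -> 'rV[R]_n)
    (v : 'cV[R]_N) (i : 'I_N) : injective X -> zero_extension X v (X i) = v i 0.
Proof.
move=> X_inj; rewrite /zero_extension; case: pickP => [j /eqP/X_inj-> //|].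
by move/(_ i); rewrite eqxx.
Qed.

(** Sums over the interior vertices are extended to all the vertices, where
    the symmetry of the edge relation can be exploited. *)
Lemma sum_interior (R : realType) (n N : nat) (X : 'I_N -> 'rV[R]_n)
    (V : {fset 'rV[R]_n}) (G : 'rV[R]_n -> R) :
  injective X -> (forall i, X i \in V) ->
  (forall Y, (forall i, X i != Y) -> G Y = 0) ->
  \sum_(Y <- V) G Y = \sum_i G (X i).
Proof.
move=> X_inj XV G0.
rewrite -(big_rmcond (mem (codom X))) => [|Y YX]; last first.
  by apply: G0 => i; apply: contra YX => /eqP <-; exact: codom_f.
rewrite -big_filter -(big_map X predT G) /=; apply: perm_big.
apply: uniq_perm; rewrite ?filter_uniq ?fset_uniq //.
  by rewrite map_inj_uniq ?index_enum_uniq.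
move=> Y; rewrite mem_filter; apply/andP/mapP => [[/codomP [i ->] _]|[i _ ->]].
  by exists i; rewrite ?mem_index_enum.
by split; [exact: codom_f | exact: XV].
Qed.

(** Summation by parts: exchanging the two ends of the edges replaces [u] at one
    end by minus [u] at the other, and the mean of the two expressions is the
    energy.  The boundary contributes nothing since the extensions vanish there. *)
Lemma dot_laplacian (R : realType) (d n : nat) (P : 'I_d -> 'rV[R]_n)
    (m N : nat) (X : 'I_N -> 'rV[R]_n) (u v : 'cV[R]_N) :
  injective X -> (forall i, X i \in vertices P m) ->
  dot u (laplacian_mx P m X *m v) = d%:R / 2 * (d + 2)%:R ^+ m *
    energy P m (zero_extension X u) (zero_extension X v).
Proof.
move=> X_inj XV; rewrite laplacian_mxE /dot; set c := _ / 2 * _.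
set U := zero_extension X u; set W := zero_extension X v; set V : seq _ := vertices P m.
have -> : \sum_i u i 0 * dirichlet_laplacian P m X v i 0 =
    c * \sum_(Z <- V) \sum_(Y <- V | adjacent P m Y Z) U Z * (W Z - W Y).
  rewrite (sum_interior X_inj XV) => [|Z XZ]; last first.
    rewrite {1}/U /zero_extension; case: pickP => [i|_]; first by rewrite (negPf (XZ i)).
    by apply: big1 => Y _; rewrite mul0r.
  rewrite mulr_sumr; apply: eq_bigr => i _.
  by rewrite mxE -mulr_sumr /U /W !zero_extensionE // mulrCA.
congr (_ * _); set S := LHS.
have S' : S = \sum_(Z <- V) \sum_(Y <- V | adjacent P m Y Z) U Y * (W Y - W Z).
  rewrite /S (exchange_big_dep predT) //=; apply: eq_bigr => Z _.
  by apply: eq_bigl => Y; exact: adjacentC.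
rewrite /energy; apply: (mulfI (x := 2)); rewrite ?pnatr_eq0 // mulVKf ?pnatr_eq0 //.
rewrite mulr_natl mulr2n {2}S' -big_split; apply: eq_bigr => Z _.
by rewrite -big_split; apply: eq_bigr => Y _ /=; ring.
Qed.

Lemma iteration_eigenvalue_le1 (R : realType) (d n m N : nat)
    (P : 'I_d -> 'rV[R]_n) (X : 'I_N -> 'rV[R]_n) (h : R) (g : R[i]) :
  (0 < d)%N -> affinely_independent P -> injective X ->
  (forall k, X k \in vertices P m) -> 0 < h ->
  root (char_poly (map_mx (real_complex R) (iteration_mx P m X h))) g ->
  h * (d + 2)%:R ^+ m <= 2 / d%:R ^+ 2 -> `|g| <= 1.
Proof.
move=> hd hP X_inj XV hh root_g hle.
have AE u v : dot u (iteration_mx P m X h *m v) = dot u v - h *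
    (d%:R / 2 * (d + 2)%:R ^+ m *
     energy P m (zero_extension X u) (zero_extension X v)).
  by rewrite mulmxBl mul1mx -scalemxAl dotBr dotZr dot_laplacian.
apply: (selfadjoint_eigenvalue_le1 (A := iteration_mx P m X h)).
- move=> u v; rewrite !AE dotC; congr (_ - _ * (_ * _)).
  by congr (_ * _); apply: eq_bigr => Z _; apply: eq_bigr => Y _; rewrite mulrC.
- move=> u; rewrite AE; set E := energy _ _ _ _; set q := _ ^+ m in hle *.
  have E0 : 0 <= E by exact: energy_ge0.
  have Ele : E <= d.*2%:R * dot u u.
    apply: le_trans (energy_le m _ hP) _; rewrite (sum_interior X_inj XV).
      rewrite le_eqVlt; apply/orP; left; apply/eqP; congr (_ * _).
      by apply: eq_bigr => k _; rewrite zero_extensionE.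
    move=> Y XY; rewrite /zero_extension; case: pickP => [k|_]; last by rewrite expr0n.
    by rewrite (negPf (XY k)).
  have d0 : 0 < d%:R :> R by rewrite ltr0n.
  have q0 : 0 <= q by rewrite exprn_ge0 ?ler0n.
  have := dot_ge0 u; move: (dot u u) Ele => D Ele D0.
  have hq : h * q * d%:R ^+ 2 <= 2 by rewrite -ler_pdivlMr ?exprn_gt0.
  have c0 : 0 <= h * (d%:R / 2 * q) by rewrite !mulr_ge0 ?invr_ge0 ?ler0n // ltW.
  have up : h * (d%:R / 2 * q) * E <= h * (d%:R / 2 * q) * (d.*2%:R * D).
    exact: ler_wpM2l.
  have eqD : h * (d%:R / 2 * q) * (d.*2%:R * D) = h * q * d%:R ^+ 2 * D.
    by rewrite -muln2 natrM; field.
  have le2 : h * q * d%:R ^+ 2 * D <= 2 * D by exact: ler_wpM2r.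
  have lo : 0 <= h * (d%:R / 2 * q) * E by exact: mulr_ge0.
  rewrite [h * (_ * E)]mulrA ler_norml; lra.
- exact: root_g.
Qed.

Local Open Scope fset_scope.

Theorem proposition3p2 (R : realType) (d m : nat) (hd : (0 < d)%N)
    (hm : (0 < m)%N) (P : 'I_d -> 'rV[R]_d.-1)
    (hP : affinely_independent P)
    (X : 'I_(#|` vertices P m| - d) -> 'rV[R]_d.-1)
    (hX : interior_enumeration P m X)
    (h : R) (hh : 0 < h)
    (gamma : 'I_(#|` vertices P m| - d) -> R[i])
    (hgamma : eigenvalue_list (iteration_mx P m X h) gamma) :
  forall i, h * (d + 2)%:R ^+ m <= 2 / d%:R ^+ 2 -> `|gamma i| <= 1.
Proof.
case: hX => X_inj XV i.
have XmV k : X k \in vertices P m.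
  by have /XV : exists k', X k' = X k by [exists k]; rewrite in_fsetD => /andP [].
apply: (iteration_eigenvalue_le1 hd hP X_inj XmV hh).
by rewrite hgamma /root horner_prod (bigD1 i) //= hornerXsubC subrr mul0r.
Qed.
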